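(* There exist a unary numerical predicate collection $(\mathcal{P},\mathrm{ar},[\![\cdot]\!])$, a relational signature $\sigma$, and a sequence $(\varphi_n)_{n\ge1}$ of $\mathrm{FO}(\mathcal{P})[\sigma]$-sentences with $\|\varphi_n\|\in O(n)$ such that for every $n\ge1$ and every weak hnf-sentence $\psi_n$ for $\mathrm{FO}(\mathcal{P})[\sigma]$ that is $3$-equivalent to $\varphi_n$, the number of distinct subformulas of $\psi_n$ of the form $\mathsf{P}\bigl(\#(y).\bigvee_{\tau\in T}\mathrm{sph}_\tau(y)-k\bigr)$ is at least $\exp_4(n)$.
   Context: Signatures are finite; relational signatures contain only relation symbols; structures are finite with non-empty universe. A numerical predicate collection is a countable set $\mathcal{P}$ of predicate names, each with an arity $\mathrm{ar}(\mathsf{P})\ge1$ and semantics $[\![\mathsf{P}]\!]\subseteq\mathbb{Z}^{\mathrm{ar}(\mathsf{P})}$; it is unary if all arities are $1$. $\mathsf{P}_\exists$ is the unary predicate with $[\![\mathsf{P}_\exists]\!]=\{1,2,\dots\}$. The logic $\mathrm{FO}(\mathcal{P})[\sigma]$ extends first-order logic over $\sigma$ by formulas $\mathsf{P}(t_1,\dots,t_m)$ ($\mathsf{P}\in\mathcal{P}$, $m=\mathrm{ar}(\mathsf{P})$), true iff the tuple of values of the $t_i$ lies in $[\![\mathsf{P}]\!]$, where counting terms are of the form $\#(y).\varphi-k$ with $y$ a variable, $\varphi$ a formula, $k\in\mathbb{N}$, whose value is $|\{a\in A:\varphi\text{ holds with }y\mapsto a\}|-k$. $\|\xi\|$ is the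 length of a formula as a word. The Gaifman graph of $\mathcal{A}$ has vertex set $A$ and an edge between distinct elements occurring together in a tuple of some relation; $\mathcal{A}$ is $d$-bounded if its Gaifman graph has maximum degree $\le d$; two formulas are $d$-equivalent if they agree on all $d$-bounded structures under all assignments. For a tuple $\bar a$, $N_r^{\mathcal{A}}(\bar a)$ is the set of elements at Gaifman distance $\le r$ from an entry of $\bar a$. An $r$-type with $n$ centres is a structure $(\mathcal{A},a_1,\dots,a_n)$ (with $a_i$ interpreting fresh constants) where $A=N_r^{\mathcal{A}}(\bar a)$; for such a $\tau$ (with $r$ fixed), $\mathrm{sph}_\tau(\bar x)$ is a first-order formula expressing that the induced substructure on $N_r^{\mathcal{A}}(\bar x)$ with centres $\bar x$ is isomorphic to $\tau$. A weak hnf-sentence for $\mathrm{FO}(\mathcal{P})[\sigma]$ is a Boolean combination of sentences of the form $\mathsf{P}\bigl(\#(y).\bigvee_{\tau\in T}\mathrm{sph}_\tau(y)-k\bigr)$ where $\mathsf{P}\in\mathcal{P}\cup\{\mathsf{P}_\exists\}$, $k\in\mathbb{N}$, and $T$ is a set of types with one centre all of the same radius $r$ (for some $r$). $\exp_0(n)=n$, $\exp_{k+1}(n)=2^{\exp_k(n)}$. *)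

(* Defs.v *)
From HB Require Import structures.
From mathcomp Require Import all_boot all_order all_algebra.
Set Implicit Arguments. Unset Strict Implicit. Unset Printing Implicit Defensive.
Import GRing.Theory Num.Theory.

Record signature := Signature { rsym : finType; rar : rsym -> nat }.

Record structure (sg : signature) := Structure {
  univ : finType;
  univ_ne : 0 < #|univ|;
  rel : forall R : rsym sg, pred ((rar R).-tuple univ) }.
Arguments rel {sg} s R _ : rename.
Arguments univ {sg} s : rename.

Definition gadj sg (A : structure sg) (a b : univ A) : bool :=
  (a != b) && [exists R : rsym sg, exists t : (rar R).-tuple (univ A),
                 [&& rel A R t, a \in t & b \in t]].

Definition bounded sg (d : nat) (A : structure sg) : bool :=
  [forall a : univ A, #|[set b | gadj a b]| <= d].

Fixpoint ball sg (A : structure sg) (r : nat) (S : {set univ A}) : {set univ A} :=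
  if r is r'.+1 then
    let B := ball r' S in B :|: [set b | [exists a in B, gadj a b]]
  else S.

Definition nbhd sg (A : structure sg) (r : nat) (a : univ A) := ball r [set a].

Record PredColl := PredCollMk {
  pname : countType;
  par : pname -> nat;
  par_pos : forall P, 0 < par P;
  psem : pname -> pred (seq int);
  psem_ar : forall P s, psem P s -> size s = par P  (* [[P]] is a subset of Z^ar(P) *) }.

Arguments par : clear implicits.
Arguments psem : clear implicits.

Definition unary (C : PredColl) : Prop := forall P, par C P = 1.

(** Variables are natural numbers. A counting term #(y).phi - k is the
    triple (y, phi, k). *)
Inductive formula (sg : signature) (PN : Type) : Type :=
  | FEq : nat -> nat -> formula sg PN
  | FRel (R : rsym sg) : (rar R).-tuple nat -> formula sg PN
  | FNeg : formula sg PN -> formula sg PN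
  | FAnd : formula sg PN -> formula sg PN -> formula sg PN
  | FOr : formula sg PN -> formula sg PN -> formula sg PN
  | FEx : nat -> formula sg PN -> formula sg PN
  | FAll : nat -> formula sg PN -> formula sg PN
  | FPred : PN -> seq (nat * formula sg PN * nat) -> formula sg PN.

Fixpoint fo_wf sg (C : PredColl) (X : seq nat) (phi : formula sg (pname C)) : bool :=
  match phi with
  | FEq x y => (x \in X) && (y \in X)
  | FRel R xs => all (fun x => x \in X) xs
  | FNeg f => fo_wf X f
  | FAnd f g => fo_wf X f && fo_wf X g
  | FOr f g => fo_wf X f && fo_wf X g
  | FEx x f => fo_wf (x :: X) f
  | FAll x f => fo_wf (x :: X) f
  | FPred P ts =>
      (size ts == par C P) &&
      all (fun t => let: (y, f, k) := t in fo_wf (y :: X) f) ts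
  end.

Definition fo_sentence sg (C : PredColl) (phi : formula sg (pname C)) : bool :=
  fo_wf [::] phi.

(** Length of a formula as a word: every variable, relation symbol,
    predicate name, natural number k, connective, quantifier, bracket,
    comma, '#', '.', '-' and '=' is one letter. *)
Fixpoint fsize sg PN (phi : formula sg PN) : nat :=
  match phi with
  | FEq x y => 3                                   (* x = y *)
  | FRel R xs => 3 + size xs + (size xs).-1         (* R ( x1 , ... , xm ) *)
  | FNeg f => 1 + fsize f                          (* ~ f *)
  | FAnd f g => 3 + fsize f + fsize g              (* ( f /\ g ) *)
  | FOr f g => 3 + fsize f + fsize g               (* ( f \/ g ) *)
  | FEx x f => 2 + fsize f                         (* E x f *)
  | FAll x f => 2 + fsize f                        (* A x f *)
  | FPred P ts =>                                  (* P ( t1 , ... , tm ) *)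
      3 + (size ts).-1 +
      sumn (map (fun t => let: (y, f, k) := t in 6 + fsize f) ts)
      (* # ( y ) . f - k *)
  end.

Definition upd (U : Type) (beta : nat -> U) (y : nat) (a : U) : nat -> U :=
  fun z => if z == y then a else beta z.

Fixpoint sat sg (C : PredColl) (A : structure sg) (beta : nat -> univ A)
    (phi : formula sg (pname C)) {struct phi} : bool :=
  match phi with
  | FEq x y => beta x == beta y
  | FRel R xs => rel A R (map_tuple beta xs)
  | FNeg f => ~~ sat beta f
  | FAnd f g => sat beta f && sat beta g
  | FOr f g => sat beta f || sat beta g
  | FEx x f => [exists a : univ A, sat (upd beta x a) f]
  | FAll x f => [forall a : univ A, sat (upd beta x a) f]
  | FPred P ts =>
      psem C P (map (fun t => let: (y, f, k) := t in
                     (Posz #|[set a : univ A | sat (upd beta y a) f]| - Posz k)%R) ts)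
  end.

Record rtype sg := RType { tstr : structure sg; tctr : univ tstr }.

Definition is_rtype sg (r : nat) (tau : rtype sg) : bool :=
  nbhd r (tctr tau) == [set: univ (tstr tau)].

Definition sph sg (r : nat) (tau : rtype sg) (A : structure sg) (a : univ A) : bool :=
  [exists f : {ffun univ (tstr tau) -> univ A},
    [&& injectiveb f, f (tctr tau) == a,
        f @: [set: univ (tstr tau)] == nbhd r a &
        [forall R : rsym sg, forall t : (rar R).-tuple (univ (tstr tau)),
           rel (tstr tau) R t == rel A R (map_tuple f t)]]].

Definition tiso sg (t1 t2 : rtype sg) : bool :=
  [exists f : {ffun univ (tstr t1) -> univ (tstr t2)},
    [&& injectiveb f, #|univ (tstr t1)| == #|univ (tstr t2)|,
        f (tctr t1) == tctr t2 &
        [forall R : rsym sg, forall t : (rar R).-tuple (univ (tstr t1)),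
           rel (tstr t1) R t == rel (tstr t2) R (map_tuple f t)]]].

(** The basic sentence  P(#(y). \/_{tau in T} sph_tau(y) - k), where
    hP = None stands for P_exists and all types in T have radius hr. *)
Record hatom sg (PN : Type) := HAtomMk {
  hP : option PN; hr : nat; hT : seq (rtype sg); hk : nat }.

Inductive hnf sg (PN : Type) : Type :=
  | HA : hatom sg PN -> hnf sg PN
  | HNeg : hnf sg PN -> hnf sg PN
  | HAnd : hnf sg PN -> hnf sg PN -> hnf sg PN
  | HOr : hnf sg PN -> hnf sg PN -> hnf sg PN.

Fixpoint hatoms sg PN (psi : hnf sg PN) : seq (hatom sg PN) :=
  match psi with
  | HA a => [:: a]
  | HNeg f => hatoms f
  | HAnd f g => hatoms f ++ hatoms g
  | HOr f g => hatoms f ++ hatoms g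
  end.

Definition hatom_wf sg (C : PredColl) (a : hatom sg (pname C)) : bool :=
  all (is_rtype (hr a)) (hT a) &&
  (if hP a is Some P then par C P == 1 else true).

Definition hnf_wf sg (C : PredColl) (psi : hnf sg (pname C)) : bool :=
  all (@hatom_wf sg C) (hatoms psi).

Definition hatom_sat sg (C : PredColl) (A : structure sg) (a : hatom sg (pname C)) : bool :=
  let v := (Posz #|[set x : univ A | has (fun tau => sph (hr a) tau x) (hT a)]|
            - Posz (hk a))%R in
  match hP a with
  | Some P => psem C P [:: v]
  | None => (0 < v)%R      (* [[P_exists]] = {1, 2, ...} *)
  end.

Fixpoint hsat sg (C : PredColl) (A : structure sg) (psi : hnf sg (pname C)) : bool :=
  match psi with
  | HA a => hatom_sat A a
  | HNeg f => ~~ hsat A f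
  | HAnd f g => hsat A f && hsat A g
  | HOr f g => hsat A f || hsat A g
  end.

Definition d_equiv sg (C : PredColl) (d : nat) (phi : formula sg (pname C))
    (psi : hnf sg (pname C)) : Prop :=
  forall (A : structure sg) (beta : nat -> univ A),
    bounded d A -> sat beta phi = hsat A psi.

Definition same_hatom sg PN (a b : hatom sg PN) : Prop :=
  [/\ hP a = hP b, hr a = hr b, hk a = hk b,
      all (fun t => has (tiso t) (hT b)) (hT a) &
      all (fun t => has (tiso t) (hT a)) (hT b)].

Fixpoint tower (k n : nat) : nat := if k is k'.+1 then 2 ^ tower k' n else n.

(** Propositional list membership (for element types without decidable equality). *)
Fixpoint occurs (T : Type) (a : T) (s : seq T) : Prop :=
  if s is b :: s' then a = b \/ occurs a s' else False.

(* Main.v *)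
From HB Require Import structures.
Require Import Defs.
From mathcomp Require Import all_boot all_order all_algebra.
From mathcomp Require Import zify.
Set Implicit Arguments. Unset Strict Implicit. Unset Printing Implicit Defensive.

(** The only predicate is "is a factorial".  Structures are forests of complete
    binary trees of depth [2^(n+1)] with labelled leaves and roots of two kinds,
    so that there are more than [tower 3 n] labellings.  The sentence says that the
    number of unmarked trees whose labelling also occurs on a marked tree is a
    factorial; comparing two trees needs only a formula of length O(n), since walks
    of length [2^k] spelling the same word are definable by repeated halving.

    Fix a nonempty set [S] of labellings, mark one copy of each, and take [m t]
    unmarked copies of each tree [t].  The sentence asserts that the sum of [m t]
    over [S] is a factorial, while an atom only sees an affine form in [m] whose
    coefficient at [t] is the number of nodes of [t] with a sphere in [T].  If no
    atom had the indicator of [S] as its coefficients, one could choose [m] such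
    that increasing it by 1 at some [t0] in [S] flips the sentence but no atom.
    Hence every nonempty [S] has its own atom. *)

(** * Locality of spheres *)

Lemma tiso_sph sg (t1 t2 : rtype sg) r (A : structure sg) (x : univ A) :
  tiso t1 t2 -> sph r t1 x -> sph r t2 x.
Proof.
case/existsP=> f /and4P[/injectiveP finj /eqP fcard /eqP fc /forallP frel].
have [g fK gK] : bijective f by apply: inj_card_bij finj _; rewrite fcard.
case/existsP=> h /and4P[/injectiveP hinj /eqP hc /eqP him /forallP hrel].
apply/existsP; exists [ffun y => h (g y)]; apply/and4P; split.
- by apply/injectiveP=> y z; rewrite !ffunE => /hinj /(can_inj gK).
- by rewrite ffunE -fc fK hc.
- rewrite -him; apply/eqP/setP=> y; apply/imsetP/imsetP=> -[z _ ->].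
    by exists (g z); rewrite ?inE ?ffunE.
  by exists (f z); rewrite ?inE ?ffunE ?fK.
apply/forallP=> R; apply/forallP=> t.
have /forallP/(_ (map_tuple g t)) /eqP E1 := frel R.
have /forallP/(_ (map_tuple g t)) /eqP E2 := hrel R.
have tE : map_tuple f (map_tuple g t) = t.
  by apply/val_inj; rewrite /= -map_comp -[RHS]map_id; apply: eq_map => y /=.
rewrite -{1}tE -E1 E2; apply/eqP; congr (Defs.rel A R _).
by apply/val_inj; rewrite /= -map_comp; apply: eq_map => y /=; rewrite ffunE.
Qed.

Lemma has_all_has (T : Type) (p : T -> pred T) (q : pred T) (s1 s2 : seq T) :
  (forall t t', p t t' -> q t -> q t') ->
  all (fun t => has (p t) s2) s1 -> has q s1 -> has q s2.
Proof.
move=> pq; elim: s1 => //= t s1 IH /andP[pt /IH {}IH] /orP[qt|//].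
by apply: sub_has pt => t' /pq; apply.
Qed.

Definition in_hatom sg PN (a : hatom sg PN) (A : structure sg) (x : univ A) :=
  has (fun tau => sph (hr a) tau x) (hT a).

(** Used in contrapositive form: atoms whose counts differ on some tree cannot be the same. *)
Lemma same_hatom_in sg PN (a b : hatom sg PN) (A : structure sg) (x : univ A) :
  same_hatom a b -> in_hatom a x = in_hatom b x.
Proof.
case=> _ rab _ sab sba; rewrite /in_hatom rab.
apply/idP/idP; [move: sab | move: sba];
  by apply: has_all_has => t t'; apply: tiso_sph.
Qed.

Section Embedding.
Variables (sg : signature) (A B : structure sg) (h : univ A -> univ B).
Hypothesis h_inj : injective h.
Hypothesis h_rel : forall R t, Defs.rel B R (map_tuple h t) = Defs.rel A R t.
Hypothesis h_closed : forall R t a b,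
  Defs.rel B R t -> h a \in t -> b \in t -> b \in codom h.

Lemma map_tuple_preim n (t : n.-tuple (univ B)) :
  {subset t <= codom h} -> exists u, t = map_tuple h u.
Proof.
move=> th; pose u := [tuple iinv (th _ (mem_tnth i t)) | i < n].
by exists u; apply: eq_from_tnth => i; rewrite tnth_map tnth_mktuple f_iinv.
Qed.

Lemma gadj_embed a b : gadj (h a) (h b) = gadj a b.
Proof.
rewrite /gadj (inj_eq h_inj); congr (_ && _); apply/existsP/existsP=> -[R].
  case/existsP=> t /and3P[Rt at_ bt].
  have [u tE] : exists u, t = map_tuple h u.
    by apply: map_tuple_preim => c ct; apply: (h_closed Rt at_ ct).
  exists R; apply/existsP; exists u.
  by move: Rt at_ bt; rewrite tE h_rel /= !mem_map // => -> -> ->.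
case/existsP=> t /and3P[Rt at_ bt]; exists R; apply/existsP.
by exists (map_tuple h t); rewrite h_rel Rt /= !map_f.
Qed.

Lemma gadj_codom a b : gadj (h a) b -> b \in codom h.
Proof.
by case/andP=> _ /existsP[R /existsP[t /and3P[Rt at_ bt]]]; apply: h_closed Rt at_ bt.
Qed.

Lemma ball_embed r (X : {set univ A}) : ball r (h @: X) = h @: ball r X.
Proof.
elim: r => //= r ->; rewrite imsetU; congr (_ :|: _); apply/setP=> b.
rewrite !inE; apply/existsP/imsetP.
  case=> _ /andP[/imsetP[a aX ->] hab].
  case/codomP: (gadj_codom hab) => c bE; move: hab; rewrite bE gadj_embed => ac.
  by exists c => //; rewrite inE; apply/existsP; exists a; rewrite aX.
case=> c; rewrite inE => /existsP[a /andP[aX ac]] ->.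
by exists (h a); rewrite gadj_embed ac imset_f.
Qed.

(** By [h_closed] the image of [h] is a union of Gaifman components. Hence the ball around [h a] is
    the image of the ball around [a], and sphere isomorphisms can be pushed forward and pulled back
    along [h]. *)
Lemma sph_embed r (tau : rtype sg) (a : univ A) : sph r tau (h a) = sph r tau a.
Proof.
have nE : nbhd r (h a) = h @: nbhd r a by rewrite /nbhd -imset_set1 ball_embed.
apply/existsP/existsP=> -[f /and4P[/injectiveP finj /eqP fc /eqP fim /forallP frel]].
  have fh y : f y \in codom h.
    have: f y \in f @: [set: univ (tstr tau)] by rewrite imset_f ?inE.
    by rewrite fim nE => /imsetP[c _ ->]; apply: codom_f.
  pose g := [ffun y => iinv (fh y)].
  have hg y : h (g y) = f y by rewrite ffunE f_iinv.
  exists g; apply/and4P; split.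
  - by apply/injectiveP=> y z /(congr1 h); rewrite !hg => /finj.
  - by apply/eqP/h_inj; rewrite hg.
  - apply/eqP/(imset_inj h_inj); rewrite -nE -fim -imset_comp.
    by apply: eq_imset => y /=.
  apply/forallP=> R; apply/forallP=> t.
  have /forallP/(_ t)/eqP -> := frel R; rewrite -h_rel; apply/eqP; congr (Defs.rel B R _).
  by apply/val_inj; rewrite /= -map_comp; apply: eq_map => y /=.
exists [ffun y => h (f y)]; apply/and4P; split.
- by apply/injectiveP=> y z; rewrite !ffunE => /h_inj/finj.
- by rewrite ffunE fc.
- rewrite nE -fim -imset_comp; apply/eqP; apply: eq_imset => y /=.
  by rewrite ffunE.
apply/forallP=> R; apply/forallP=> t.
have /forallP/(_ t)/eqP -> := frel R; rewrite -h_rel; apply/eqP; congr (Defs.rel B R _).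
by apply/val_inj; rewrite /= -map_comp; apply: eq_map => y /=; rewrite ffunE.
Qed.

End Embedding.

(** * Weights separating a sum from other affine forms *)

(** Reduction modulo [Q] recovers the lowest digit; cancelling it and dividing by [Q] leaves the
    shorter expansions. *)
Lemma base_expansion_inj Q n (f g : 'I_n -> nat) :
  (forall i, f i < Q) -> (forall i, g i < Q) ->
  \sum_(i < n) f i * Q ^ i = \sum_(i < n) g i * Q ^ i -> f =1 g.
Proof.
elim: n f g => [|n IH] f g fQ gQ; first by move=> _ [].
rewrite !big_ord_recl !expn0 !muln1.
have shift (u : 'I_n.+1 -> nat) : \sum_(i < n) u (lift ord0 i) * Q ^ lift ord0 i =
    Q * \sum_(i < n) u (lift ord0 i) * Q ^ i.
  by rewrite big_distrr; apply: eq_bigr => i _; rewrite /= /bump add1n expnS mulnCA.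
rewrite !shift => E.
have Q0 : 0 < Q by apply: leq_ltn_trans (fQ ord0).
have E0 : f ord0 = g ord0.
  move/(congr1 (modn^~ Q)): E.
  by rewrite ![_ + Q * _]addnC ![Q * _]mulnC !modnMDl !modn_small.
move=> i; case: (unliftP ord0 i) => [j ->|-> //].
apply: (IH (f \o lift ord0) (g \o lift ord0)) => [k|k|]; rewrite /= ?fQ ?gQ //.
by move/eqP: E; rewrite E0 eqn_add2l eqn_pmul2l // => /eqP.
Qed.

(** Exponents start at 1, which keeps position 0 free for an additive constant. *)
Definition digit_weight (L : finType) Q (t : L) := Q ^ (enum_rank t).+1.

Lemma digit_weight_inj (L : finType) Q (f g : L -> nat) e e' :
  (forall t, f t < Q) -> (forall t, g t < Q) -> e < Q -> e' < Q ->
  \sum_t f t * digit_weight Q t + e = \sum_t g t * digit_weight Q t + e' ->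
  f =1 g.
Proof.
move=> fQ gQ eQ e'Q E t.
pose dig (h : L -> nat) d (i : 'I_#|L|.+1) := oapp (h \o enum_val) d (unlift ord0 i).
have digQ (h : L -> nat) d : (forall t, h t < Q) -> d < Q -> forall i, dig h d i < Q.
  by move=> hQ dQ i; rewrite /dig; case: (unlift ord0 i) => /=.
have digE (h : L -> nat) d :
    \sum_(i < #|L|.+1) dig h d i * Q ^ i = \sum_t h t * digit_weight Q t + d.
  rewrite big_ord_recl expn0 muln1 /dig unlift_none /= addnC; congr (_ + _).
  rewrite (reindex (@enum_rank L)) /=; last exact: onW_bij (enum_rank_bij _).
  by apply: eq_bigr => u _; rewrite liftK /= enum_rankK.
have /(_ (lift ord0 (enum_rank t))) := base_expansion_inj
  (digQ f e fQ eQ) (digQ g e' gQ e'Q) (etrans (digE f e) (etrans E (esym (digE g e')))).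
by rewrite /dig liftK /= enum_rankK.
Qed.

Definition is_fact (v : int) : bool := [exists j : 'I_`|v|.+1, v == Posz j`!].

Lemma is_factP v : reflect (exists j, v = Posz j`!) (is_fact v).
Proof.
apply: (iffP existsP) => [[j /eqP ->]|[j ->]]; first by exists (nat_of_ord j).
have j_le : j < (absz (Posz j`!)).+1 by rewrite ltnS fact_geq.
by exists (Ordinal j_le).
Qed.

(** Weak monotonicity of the factorial suffices, so the coincidence of 0! and 1! does no harm. *)
Lemma fact_between j J : (J.-1)`! < j`! < J.+1`! -> j = J.
Proof.
case/andP=> lt1 lt2.
have : j <= J by rewrite leqNgt; apply: contraL lt2 => ?; rewrite -leqNgt leq_fact.
have : ~~ (j <= J.-1) by apply: contraL lt1 => ?; rewrite -leqNgt leq_fact.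
by case: J {lt1 lt2} => [|J] /=; lia.
Qed.

Lemma exists_ubound (X : Type) (f : X -> nat) (s : seq X) :
  exists K, all (fun a => f a < K) s.
Proof.
elim: s => [|a s [K IH]]; first by exists 0.
exists (maxn (f a).+1 K); rewrite /= leq_max leqnn /=.
by apply: sub_all IH => b; rewrite leq_max orbC => ->.
Qed.

(** The two tests an atom can apply to its value: the factorial predicate and [P_exists]. *)
Definition same_sign_fact (v v' : int) :=
  (is_fact v == is_fact v') && ((0 < v)%R == (0 < v')%R).

(* All weights except [m t0] are distinct powers of a large [Q], and [m t0] tops
   the total over [S] up to a huge factorial.  A linear form not involving [t0]
   does not see the increment; any other one has a value whose only possible
   factorial is that total, which uniqueness of base-[Q] digits excludes. *)
Lemma separating_weights (L : finType) (S : {set L}) (t0 : L) (X : Type)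
    (s : seq X) (c : X -> L -> nat) (e k : X -> nat) :
  t0 \in S -> ~~ has (fun a => [forall t, c a t == (t \in S)]) s ->
  exists m : L -> nat, let m' t := m t + (t == t0) in
  [/\ is_fact (Posz (\sum_(t in S) m t)), ~~ is_fact (Posz (\sum_(t in S) m' t)) &
      all (fun a => same_sign_fact
             (Posz (\sum_t m t * c a t + e a) - Posz (k a))%R
             (Posz (\sum_t m' t * c a t + e a) - Posz (k a))%R) s].
Proof.
move=> t0S; rewrite -all_predC => cS.
(* [Q] exceeds every digit compared below: coefficients, the indicator of [S], [k a], and the
   constant [e a] even when raised by 1. *)
have [Q ltQ] := exists_ubound (fun a => \sum_t c a t + e a + k a + 2) s.
pose m0 := @digit_weight L Q.
pose Z := \sum_(t in S | t != t0) m0 t.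
pose w a := \sum_(t | t != t0) m0 t * c a t.
have [K ltK] := exists_ubound (fun a => w a + 2 * c a t0 + e a + k a) s.
(* Large enough that forms with a positive coefficient at [t0] take values strictly between (J-1)!
   and (J+1)!, before and after the increment. *)
pose J := K + 2 * Z + 3.
have Jfact : J`! = J * (J.-1)`! by rewrite /J addnS factS.
have F_gt0 := fact_gt0 J.-1.
have lt_ZJ : Z + Z < J`! by apply: leq_trans (fact_geq J); rewrite /J; lia.
pose m t := if t == t0 then J`! - Z else m0 t.
have m0E t : t != t0 -> m t = m0 t by rewrite /m => /negbTE ->.
have m_t0 : m t0 = J`! - Z by rewrite /m eqxx.
have sumS : \sum_(t in S) m t = J`!.
  rewrite (bigD1 t0) //= m_t0 (eq_bigr m0) => [|t /andP[_ /m0E] //].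
  by rewrite -/Z; lia.
have sumS' : \sum_(t in S) (m t + (t == t0)) = J`!.+1.
  rewrite big_split /= sumS (bigD1 t0) //= eqxx big1 ?addn0 ?addn1 // => t.
  by case/andP=> _ /negbTE ->.
exists m => m'; split.
- by apply/is_factP; exists J; rewrite sumS.
- rewrite sumS'; apply/negP => /is_factP[j [Ej]].
  have jJ : j = J.
    apply: fact_between; rewrite -Ej !factS; apply/andP; split.
      by rewrite ltnS leq_fact ?leq_pred.
    by move: lt_ZJ; rewrite /J; nia.
  by move: Ej; rewrite jJ; lia.
(* [X] has no decidable equality, so the facts about the list are merged into a single [all] and
   used pointwise. *)
move: (conj cS ltQ) => /andP; rewrite -all_predI => {cS ltQ} cSQ.
move: (conj cSQ ltK) => /andP; rewrite -all_predI => {cSQ ltK}.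
apply: sub_all => a /andP[/andP[/= ct ltQa] ltKa]; set c0 := c a t0 in ltKa.
have sumE : \sum_t m t * c a t = (J`! - Z) * c0 + w a.
  rewrite (bigD1 t0) //= m_t0; congr (_ + _).
  by apply: eq_bigr => u /m0E ->.
have sumE' : \sum_t m' t * c a t = (J`! - Z) * c0 + w a + c0.
  rewrite -sumE /m' (eq_bigr (fun t => m t * c a t + (t == t0) * c a t)).
    rewrite big_split /=; congr (_ + _); rewrite (bigD1 t0) //= eqxx mul1n.
    by rewrite big1 ?addn0 // => u /negbTE ->.
  by move=> u _; rewrite mulnDl.
rewrite /same_sign_fact sumE sumE'.
case: (posnP c0) => [->|c0_gt0]; first by rewrite !addn0 !eqxx.
(* With coefficient 1 at [t0], the value J! would force this equation, [d] being the constant before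
   or after the increment. Comparing base-[Q] digits would then make [c a] the indicator of [S]. *)
have digits d : c0 = 1 -> d <= e a + 1 -> w a + d <> Z + k a.
  move=> c01 led E; case/negP: ct; apply/forallP => t.
  have [-> | tt0] := eqVneq t t0; first by rewrite -/c0 c01 t0S.
  pose f u := if u == t0 then 0 else c a u.
  pose g u := if u == t0 then 0 else (u \in S) : nat.
  suff /(_ t) : f =1 g by rewrite /f /g (negbTE tt0) => ->.
  have le_c u : c a u <= \sum_u c a u by rewrite (bigD1 u) //= leq_addr.
  apply: (@digit_weight_inj _ Q f g d (k a)) => [u|u|||].
  - by rewrite /f; case: eqP => _; [lia | move: (le_c u); lia].
  - by rewrite /g; case: eqP => _; case: (u \in S); lia.
  - by lia.
  - by lia.
  have -> : \sum_u f u * digit_weight Q u = w a.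
    rewrite /w [RHS]big_mkcond; apply: eq_bigr => u _; rewrite /f.
    by case: eqP => //= _; rewrite mulnC.
  rewrite E; congr (_ + _); rewrite /Z big_mkcondr big_mkcond /=.
  by apply: eq_bigr => u _; rewrite /g /m0; case: eqP; case: (u \in S); rewrite ?mul1n.
have SJ : J.+1`! = J.+1 * J`! by rewrite factS.
have notfact v : (J.-1)`! < v -> v < J.+1`! -> v <> J`! -> is_fact (Posz v) = false.
  move=> lt1 lt2 ne; apply/negbTE/negP => /is_factP[j [Ej]]; apply: ne; rewrite Ej.
  by rewrite (@fact_between j J) // -Ej lt1.
have lbN : (J.-1)`! + Z + k a < J`! by rewrite Jfact; move: F_gt0 ltKa; rewrite /J; nia.
have prodE : (J`! - Z) * c0 = (J`! - Z) + (J`! - Z) * c0.-1.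
  by rewrite -mulnS prednK.
have lb : J`! <= (J`! - Z) * c0 + Z.
  by rewrite prodE; move: (_ * c0.-1) => p; lia.
have ub : (J`! - Z) * c0 <= J`! * c0 by rewrite leq_mul2r leq_subr orbT.
have ubN : J`! * c0 + w a + c0 + e a < J.+1`!.
  have lt_J : c0 + (w a + c0 + e a) < J.+1 by move: ltKa; rewrite /J; lia.
  apply: leq_ltn_trans (_ : _ <= J`! * (c0 + (w a + c0 + e a))) _.
    by rewrite mulnDr -!addnA leq_add2l leq_pmull ?fact_gt0.
  by rewrite SJ mulnC ltn_pmul2r ?fact_gt0.
(* A coefficient of at least 2 at [t0] lifts the value above J!, because J! exceeds 2Z + [k a]. *)
have lb2 : c0 <> 1 -> J`! + J`! <= (J`! - Z) * c0 + Z + Z.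
  move=> c01; rewrite prodE; have : J`! - Z <= (J`! - Z) * c0.-1 by rewrite leq_pmulr //; lia.
  by move: (_ * c0.-1) => p; lia.
have subE x : k a <= x -> (Posz x - Posz (k a))%R = Posz (x - k a) by lia.
have big : Z + Z + k a < J`!.
  by apply: leq_trans (fact_geq J); move: ltKa; rewrite /J; lia.
have digV d : c0 = 1 -> d <= e a + 1 -> (J`! - Z) * c0 + w a + d - k a <> J`!.
  by move=> c01 led; have := digits d c01 led; rewrite c01 muln1; lia.
move: ((J`! - Z) * c0) (J`! * c0) lb ub ubN lb2 digV => V V' lb ub ubN lb2 digV.
have neqJ d : d <= e a + c0 -> d <= e a + 1 \/ c0 <> 1 -> V + w a + d - k a <> J`!.
  case: (eqVneq c0 1) => [c01 ? [|//]|/eqP/lb2]; last by lia.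
  exact: digV.
rewrite !subE; try lia.
have E1 := neqJ (e a) _ _.
have E2 : V + w a + c0 + e a - k a <> J`!.
  rewrite -addnA; apply: neqJ; rewrite addnC // leq_add2l.
  by case: (c0 =P 1) => [->|]; [left | right].
by rewrite !notfact //; lia.
Qed.

(** * Forests of labelled binary trees *)

Definition fact_sem (_ : unit) (s : seq int) : bool :=
  if s is [:: v] then is_fact v else false.

Lemma fact_sem_size P s : fact_sem P s -> size s = 1.
Proof. by case: s => [|v []]. Qed.

Definition fact_coll : PredColl :=
  @PredCollMk unit (fun=> 1) (fun=> isT) fact_sem fact_sem_size.
Arguments fact_coll : simpl never.

Variant tree_sym := Child of bool | Leaf | Root of bool.

Definition tree_sym_code (R : tree_sym) : bool + option bool :=
  match R with Child b => inl b | Leaf => inr None | Root m => inr (Some m) end.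
Definition tree_sym_decode (x : bool + option bool) : tree_sym :=
  match x with inl b => Child b | inr None => Leaf | inr (Some m) => Root m end.
Lemma tree_sym_codeK : cancel tree_sym_code tree_sym_decode.
Proof. by case. Qed.
HB.instance Definition _ := Finite.copy tree_sym (can_type tree_sym_codeK).

Definition tree_sig : signature :=
  @Signature tree_sym (fun R => if R is Child _ then 2 else 1).

Section Forest.
Variable D : nat.

(* Labels of the leaves of the complete binary tree of depth [D], whose nodes are
   the words of [D.-bseq bool]; only words of length [D] carry labels. *)
Definition labelling := {set D.-tuple bool}.

Section Structure.
Variables (I : finType) (I_ne : 0 < #|I|) (lab : I -> labelling) (mk : I -> bool).

(* One tree per index [i], labelled by [lab i] and with its root marked by [mk i]. *)
Definition forest_rel (R : tree_sym) (s : seq (I * D.-bseq bool)) : bool :=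
  match R, s with
  | Child b, [:: x; y] => (x.1 == y.1) && (rcons x.2 b == y.2)
  | Leaf, [:: x] => [exists w in lab x.1, tval w == x.2]
  | Root m, [:: x] => nilp x.2 && (mk x.1 == m)
  | _, _ => false
  end.

Lemma forest_ne : 0 < #|{: I * D.-bseq bool}|.
Proof.
rewrite card_prod muln_gt0 I_ne; apply/card_gt0P.
by exists (insub_bseq D [::]).
Qed.

Definition forest : structure tree_sig :=
  @Structure tree_sig _ forest_ne (fun R t => forest_rel R t).

Lemma forest_rel_tree R s x y : forest_rel R s -> x \in s -> y \in s -> x.1 = y.1.
Proof.
case: R => [b||m]; case: s => [|u [|v []]] //=; last 2 first.
- by move=> _; rewrite !inE => /eqP-> /eqP->.
- by move=> _; rewrite !inE => /eqP-> /eqP->.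
by case/andP=> /eqP uv _; rewrite !inE => /orP[]/eqP-> /orP[]/eqP->.
Qed.

Lemma forest_gadj (x y : univ forest) : gadj x y ->
  x.1 = y.1 /\ exists b, rcons x.2 b = y.2 :> seq bool \/ rcons y.2 b = x.2 :> seq bool.
Proof.
case/andP=> neq /existsP[R /existsP[t /and3P[/= Rt xt yt]]].
split; first exact: forest_rel_tree Rt xt yt.
move: (tval t) Rt (xt : x \in tval t) (yt : y \in tval t) => s {xt yt t}.
move: neq.
case: R => [b||m]; case: s => [|u [|v []]] //=; last 2 first.
- by move=> neq _; rewrite !inE => /eqP xE /eqP yE; rewrite xE yE eqxx in neq.
- by move=> neq _; rewrite !inE => /eqP xE /eqP yE; rewrite xE yE eqxx in neq.
move=> neq /andP[_ /eqP E]; rewrite !inE.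
case/orP=> /eqP xE /orP[]/eqP yE; rewrite ?xE ?yE ?eqxx // in neq *.
  by exists b; left.
by exists b; right.
Qed.

(** Neighbours stay in the tree of [x], so their words identify them; the candidates are the two
    children and the parent, whose word lacks the last letter. *)
Lemma forest_bounded : bounded 3 forest.
Proof.
apply/forallP=> x; rewrite cardE.
pose val2 (y : univ forest) : seq bool := y.2.
rewrite -(size_map val2); pose p := val2 x.
apply: (@uniq_leq_size _ _ [:: rcons p false; rcons p true; take (size p).-1 p]).
  rewrite map_inj_in_uniq ?enum_uniq // => y z; rewrite !mem_enum !inE.
  case/forest_gadj=> xy _ /forest_gadj[xz _] yz.
  case: y z xy xz yz => [i u] [j v] /= <- <- uv; congr (_, _).
  exact: val_inj.
move=> q /mapP[y yx ->]; move: yx; rewrite mem_enum inE => /forest_gadj[_ [b [E|E]]].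
  by rewrite /val2 -E /p /val2 !inE; case: b {E}; rewrite eqxx ?orbT.
have -> : take (size p).-1 p = val2 y.
  by rewrite /p /val2 -E size_rcons -cats1 take_size_cat.
by rewrite !inE eqxx !orbT.
Qed.

End Structure.

Definition tree (t : labelling) (m : bool) : structure tree_sig :=
  @forest unit (eq_leq (esym card_unit)) (fun=> t) (fun=> m).

Definition hcount (a : hatom tree_sig unit) t m :=
  #|[set x : univ (tree t m) | in_hatom a x]|.

Lemma card_set_prod (J K : finType) (q : pred (J * K)) :
  #|[set x | q x]| = \sum_(j : J) #|[set k | q (j, k)]|.
Proof.
rewrite -sum1dep_card; under [RHS]eq_bigr do rewrite -sum1dep_card.
by rewrite pair_big_dep /=; apply: eq_bigl => -[].
Qed.

(** No tuple joins two trees, so [sph_embed] allows each tree to be counted in isolation. This is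
    why an atom sees an affine form in the multiplicities. *)
Lemma forest_hcount (I : finType) (I_ne : 0 < #|I|) (lab : I -> labelling) mk a :
  #|[set x : univ (@forest I I_ne lab mk) | in_hatom a x]|
    = \sum_i hcount a (lab i) (mk i).
Proof.
rewrite /hcount card_set_prod; apply: eq_bigr => i _.
rewrite card_set_prod (big_pred1 tt) => [|[] //].
apply: eq_card => p; rewrite !inE /in_hatom; apply: eq_has => tau.
pose h (x : univ (tree (lab i) (mk i))) : univ (forest I_ne lab mk) := (i, x.2).
apply: (@sph_embed _ (tree (lab i) (mk i)) _ h _ _ _ _ _ (tt, p)).
- by move=> [[] u] [[] v] [->].
- by move=> [b||m] [[|x [|y []]] //= sz]; rewrite /= ?eqxx //; case: x y {sz} => [[] ?] [[] ?].
move=> R t x y /= Rt xt yt; apply/codomP; exists (tt, y.2).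
by have /= := forest_rel_tree Rt xt yt; case: y {yt} => j v /= <-.
Qed.

End Forest.

(** * The sentences *)

Notation form := (formula tree_sig (pname fact_coll)).

Definition child b x y : form := @FRel tree_sig _ (Child b) [tuple x; y].
Definition leaf x : form := @FRel tree_sig _ Leaf [tuple x].
Definition root m x : form := @FRel tree_sig _ (Root m) [tuple x].

Definition eq4 (a b c d x y z u : nat) : form :=
  FAnd (FAnd (FEq _ _ a x) (FEq _ _ b y)) (FAnd (FEq _ _ c z) (FEq _ _ d u)).

(* The walks from 0 to 1 and from 2 to 3 spell the same word, of length 2^k: they
   are halved at 4 and 5, and quantifying over both halves keeps the subformula unique. *)
Fixpoint same_path (k : nat) : form :=
  if k is k'.+1 then
    FEx 4 (FEx 5 (FAll 6 (FAll 7 (FAll 8 (FAll 9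
      (FOr (FNeg (FOr (eq4 6 7 8 9 0 4 2 5) (eq4 6 7 8 9 4 1 5 3)))
           (FEx 0 (FEx 1 (FEx 2 (FEx 3
             (FAnd (eq4 0 1 2 3 6 7 8 9) (same_path k'))))))))))))
  else FOr (FAnd (child false 0 1) (child false 2 3)) (FAnd (child true 0 1) (child true 2 3)).

Definition same_label : form :=
  FOr (FAnd (leaf 1) (leaf 3)) (FAnd (FNeg (leaf 1)) (FNeg (leaf 3))).

(** Meant for variables 0 and 2 at roots of trees of depth [2 ^ k], where the walks end exactly at
    leaves. *)
Definition same_leaves (k : nat) : form :=
  FAll 1 (FAll 3 (FOr (FNeg (same_path k)) same_label)).

Definition copied k : form :=
  FAnd (root false 0) (FEx 2 (FAnd (root true 2) (same_leaves k))).

Definition count_copies (k : nat) : form :=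
  @FPred tree_sig (pname fact_coll) tt
    [:: (0, copied k, 0)].

Lemma same_path_wf k (X : seq nat) :
  {subset [:: 0; 1; 2; 3] <= X} -> @fo_wf tree_sig fact_coll X (same_path k).
Proof.
elim: k X => [|k IH] X sX; have [[X0 X1] [X2 X3]] :
    (0 \in X /\ 1 \in X) /\ (2 \in X /\ 3 \in X) by rewrite !sX.
  by rewrite /= X0 X1 X2 X3.
rewrite /= !inE X0 X1 X2 X3 ?orbT /= IH // => x.
by rewrite !inE => /or4P[]/eqP->; rewrite ?eqxx ?orbT.
Qed.

Lemma count_copies_sentence k : @fo_sentence tree_sig fact_coll (count_copies k).
Proof.
rewrite /fo_sentence /=.
by rewrite same_path_wf // => x; rewrite !inE => /or4P[]/eqP->; rewrite ?eqxx ?orbT.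
Qed.

(** [same_path] has one recursive call, so doubling the walk length costs only a constant number of
    letters. *)
Lemma count_copies_size k : fsize (count_copies k) <= 100 * k.+1.
Proof.
have E : fsize (same_path k) = 93 * k + 33.
  by elim: k => [|k IH] //=; rewrite IH; lia.
by rewrite /= E; lia.
Qed.

Section Semantics.
Variables (D : nat) (I : finType) (I_ne : 0 < #|I|).
Variables (lab : I -> labelling D) (mk : I -> bool).
Let A := forest I_ne lab mk.

Definition spells (w : seq bool) (x y : univ A) : bool :=
  (x.1 == y.1) && (x.2 ++ w == y.2 :> seq bool).

(** The midpoint exists because its word is a prefix of that of [y], hence short enough to be a
    node. *)
Lemma spells_cat w1 w2 x y :
  spells (w1 ++ w2) x y <-> exists z, spells w1 x z && spells w2 z y.
Proof.
split=> [/andP[/eqP xy /eqP E]|[z /andP[/andP[/eqP xz /eqP E1] /andP[/eqP zy /eqP E2]]]].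
  have sz : size (x.2 ++ w1) <= D.
    by apply: leq_trans (size_bseq y.2); rewrite -E catA [in leqRHS]size_cat leq_addr.
  by exists (x.1, Bseq sz); rewrite /spells /= xy -E -catA !eqxx.
by rewrite /spells xz zy -E2 -E1 catA !eqxx.
Qed.

Lemma sat_same_path k (beta : nat -> univ A) :
  sat (C := fact_coll) beta (same_path k) <->
  exists w, [/\ size w = 2 ^ k, spells w (beta 0) (beta 1) & spells w (beta 2) (beta 3)].
Proof.
elim: k beta => [|k IH] beta.
  split=> /=.
    by case/orP=> /andP[]; rewrite -!cats1 => ? ?; [exists [:: false] | exists [:: true]].
  case=> -[|b [|? ?]] [] // _.
  by rewrite /spells !cats1; case: b => -> ->; rewrite ?orbT.
split=> [/= /existsP[u /existsP[v /forallP H]] | ].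
  (* Either pair of halves satisfies the guard of the universal quantifiers, so one word is read by
     both half walks. *)
  have half a b c d : (a, b, c, d) = (beta 0, u, beta 2, v) \/
      (a, b, c, d) = (u, beta 1, v, beta 3) ->
      exists w, [/\ size w = 2 ^ k, spells w a b & spells w c d].
    move=> abcd.
    move: H => /(_ a)/forallP/(_ b)/forallP/(_ c)/forallP/(_ d) /orP[|].
      by rewrite /upd /=; case: abcd => -[-> -> -> ->]; rewrite !eqxx ?orbT.
    case/existsP=> a' /existsP[b'] /existsP[c'] /existsP[d'] /andP[E /IH].
    move: E; rewrite /upd /= => /andP[/andP[/eqP-> /eqP->] /andP[/eqP-> /eqP->]].
    by [].
  have [w1 [sz1 w1a w1c]] := half _ _ _ _ (or_introl erefl).
  have [w2 [sz2 w2a w2c]] := half _ _ _ _ (or_intror erefl).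
  exists (w1 ++ w2); split; first by rewrite size_cat sz1 sz2 expnS mul2n addnn.
    by apply/spells_cat; exists u; rewrite w1a.
  by apply/spells_cat; exists v; rewrite w1c.
case=> w [sz]; rewrite -(cat_take_drop (2 ^ k) w).
have sz1 : size (take (2 ^ k) w) = 2 ^ k.
  by rewrite size_takel // sz leq_exp2l.
have sz2 : size (drop (2 ^ k) w) = 2 ^ k.
  by rewrite size_drop sz expnS mul2n -addnn addnK.
move=> /spells_cat[u /andP[u1 u2]] /spells_cat[v /andP[v1 v2]] /=.
apply/existsP; exists u; apply/existsP; exists v.
apply/forallP=> a; apply/forallP=> b; apply/forallP=> c; apply/forallP=> d.
rewrite -implybE; apply/implyP => abcd.
apply/existsP; exists a; apply/existsP; exists b.
apply/existsP; exists c; apply/existsP; exists d.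
rewrite /upd /= !eqxx /=; apply/IH => /=; move: abcd; rewrite /upd /=.
case/orP=> /andP[/andP[/eqP-> /eqP->] /andP[/eqP-> /eqP->]].
  by exists (take (2 ^ k) w).
by exists (drop (2 ^ k) w).
Qed.

Lemma sat_leaf (beta : nat -> univ A) x w :
  (beta x).2 = tval w :> seq bool ->
  sat (C := fact_coll) beta (leaf x) = (w \in lab (beta x).1).
Proof.
move=> E /=; apply/exists_inP/idP => [[w' w'l /eqP E']|wl]; last by exists w; rewrite ?E.
by rewrite -(_ : w' = w) //; apply: val_inj; rewrite /= E' E.
Qed.

Lemma sat_same_label (beta : nat -> univ A) w :
  (beta 1).2 = tval w :> seq bool -> (beta 3).2 = tval w :> seq bool ->
  sat (C := fact_coll) beta same_label = ((w \in lab (beta 1).1) == (w \in lab (beta 3).1)).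
Proof.
move=> E1 E3; rewrite -(sat_leaf E1) -(sat_leaf E3) /=.
by do 2!case: [exists _ in _, _].
Qed.

(** Walks of length [D] from a root reach every leaf, and equal words lead to corresponding
    leaves. *)
Lemma sat_same_leaves k (beta : nat -> univ A) : D = 2 ^ k ->
  nilp (beta 0).2 -> nilp (beta 2).2 ->
  sat (C := fact_coll) beta (same_leaves k) = (lab (beta 0).1 == lab (beta 2).1).
Proof.
move=> Dk /nilP n0 /nilP n2; apply/forallP/eqP => [H | E y].
  apply/setP => w.
  have szw : size (tval w) <= D by rewrite size_tuple.
  pose y : univ A := ((beta 0).1, Bseq szw).
  pose z : univ A := ((beta 2).1, Bseq szw).
  have /orP[/negP[]|] : sat (C := fact_coll) (upd (upd beta 1 y) 3 z)
    (FOr (FNeg (same_path k)) same_label) by move: H => /(_ y)/forallP/(_ z).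
    apply/sat_same_path; exists (tval w).
    by rewrite size_tuple /spells /upd /= n0 n2 !eqxx.
  by move=> sl; apply/eqP; rewrite -(@sat_same_label (upd (upd beta 1 y) 3 z)).
apply/forallP=> z; set b := upd _ _ _.
apply: (_ : sat (C := fact_coll) b (FOr (FNeg (same_path k)) same_label)).
apply/orP; case pE: (sat (C := fact_coll) b (same_path k)); last by left; apply: negbT.
right; case/sat_same_path: pE => w [sz /andP[/eqP y1 /eqP y2] /andP[/eqP z1 /eqP z2]].
have szw : size w == D by rewrite sz Dk.
apply: (_ : sat (C := fact_coll) b same_label).
rewrite (@sat_same_label _ (Tuple szw)).
- by rewrite -[y.1]y1 -[z.1]z1 /b /upd /= E.
- by move: y2; rewrite /b /upd /= n0.
by move: z2; rewrite /b /upd /= n2.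
Qed.

Lemma satAnd (beta : nat -> univ A) (f g : form) :
  sat (C := fact_coll) beta (FAnd f g) =
  sat (C := fact_coll) beta f && sat (C := fact_coll) beta g.
Proof. by []. Qed.

Lemma satEx (beta : nat -> univ A) x (f : form) :
  sat (C := fact_coll) beta (FEx x f) = [exists a, sat (C := fact_coll) (upd beta x a) f].
Proof. by []. Qed.

Lemma sat_root (beta : nat -> univ A) m x :
  sat (C := fact_coll) beta (root m x) = nilp (beta x).2 && (mk (beta x).1 == m).
Proof. by []. Qed.

Lemma sat_copied k (beta : nat -> univ A) : D = 2 ^ k ->
  sat (C := fact_coll) beta (copied k) =
  nilp (beta 0).2 &&
  (~~ mk (beta 0).1 && [exists j, mk j && (lab j == lab (beta 0).1)]).
Proof.
move=> Dk; rewrite satAnd sat_root satEx eqbF_neg -andbA.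
case n0: (nilp (beta 0).2); rewrite // !andTb; congr (_ && _).
apply/existsP/existsP => [[z]|[j /andP[mj E]]].
  rewrite satAnd sat_root => /andP[/andP[n2 /eqP m2]].
  by rewrite sat_same_leaves //= eq_sym => E; exists z.1; rewrite m2 E.
exists (j, (beta 0).2); rewrite satAnd sat_root sat_same_leaves //=.
by rewrite /upd /= n0 mj eq_sym E.
Qed.

Lemma sat_count_copies k (beta : nat -> univ A) : D = 2 ^ k ->
  sat (C := fact_coll) beta (count_copies k) =
  is_fact (Posz (\sum_i (~~ mk i && [exists j, mk j && (lab j == lab i)] : nat))).
Proof.
move=> Dk.
rewrite -[LHS]/(is_fact (Posz #|[set a | sat (C := fact_coll) (upd beta 0 a) (copied k)]| - 0)%R).
rewrite GRing.subr0; congr (is_fact (Posz _)).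
(* Only roots can satisfy [copied], so each tree contributes 0 or 1. *)
rewrite card_set_prod; apply: eq_bigr => i _.
under eq_finset do rewrite sat_copied //.
set q := _ && _; case: q.
  rewrite -[RHS](card1 (insub_bseq D [::] : D.-bseq bool)); apply: eq_card => p.
  rewrite !inE andbT /=; apply/nilP/eqP => [E|->]; last by rewrite /insub_bseq insubdK.
  by apply: val_inj; rewrite /= E /insub_bseq insubdK.
by apply: eq_card0 => p; rewrite !inE andbF.
Qed.

End Semantics.

(** * An atom for every set of labellings *)

Section Multiforest.
Variables (D : nat) (S : {set labelling D}) (t0 : labelling D) (t0S : t0 \in S).

Definition marked_label := {t : labelling D | t \in S}.

(** Labellings outside [S] get unmarked trees too: the sentence ignores these, but atoms may count
    their nodes. *)
Definition copies (m : labelling D -> nat) :=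
  ({t : labelling D & 'I_(m t)} + marked_label)%type.

Lemma copies_ne m : 0 < #|{: copies m}|.
Proof. by apply/card_gt0P; exists (inr (exist _ t0 t0S)). Qed.

Definition copy_label m (i : copies m) : labelling D :=
  match i with inl p => tag p | inr x => val x end.

Definition copy_marked m (i : copies m) := if i is inr _ then true else false.

Definition multiforest m :=
  forest (copies_ne m) (@copy_label m) (@copy_marked m).

Lemma sum_tag (m F : labelling D -> nat) :
  \sum_(p : {t : labelling D & 'I_(m t)}) F (tag p) = \sum_t m t * F t.
Proof.
rewrite -(@sig_big_dep _ _ _ _ (fun t => 'I_(m t)) xpredT (fun _ => xpredT)
            (fun t _ => F t)) /=.
by apply: eq_bigr => t _; rewrite sum_nat_const card_ord.
Qed.

Lemma sat_multiforest m k (beta : nat -> univ (multiforest m)) : D = 2 ^ k ->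
  sat (C := fact_coll) beta (count_copies k) = is_fact (Posz (\sum_(t in S) m t)).
Proof.
move=> Dk; rewrite sat_count_copies //; congr (is_fact (Posz _)).
rewrite big_sumType /= [X in _ + X]big1 ?addn0 => [|//].
have E (p : {t : labelling D & 'I_(m t)}) :
    [exists j : copies m, copy_marked j && (copy_label j == tag p)] = (tag p \in S).
  apply/existsP/idP => [[[//|x] /andP[_ /eqP <-]]|pS]; first exact: valP.
  by exists (inr (exist _ (tag p) pS)); rewrite /= eqxx.
under eq_bigr do rewrite E.
rewrite (sum_tag m (fun t => t \in S)) [RHS]big_mkcond.
by apply: eq_bigr => t _; case: (t \in S); rewrite ?muln1 ?muln0.
Qed.

Lemma card_multiforest m a :
  #|[set x : univ (multiforest m) | in_hatom a x]| =
  \sum_t m t * hcount a t false + \sum_(x : marked_label) hcount a (val x) true.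
Proof.
by rewrite forest_hcount big_sumType /= (sum_tag m (fun t => hcount a t false)).
Qed.

End Multiforest.

Lemma hsat_ext sg (C : PredColl) (A B : structure sg) (psi : hnf sg (pname C)) :
  all (fun a => hatom_sat A a == hatom_sat B a) (hatoms psi) -> hsat A psi = hsat B psi.
Proof.
elim: psi => [a|f IH|f IHf g IHg|f IHf g IHg] /=; rewrite ?all_cat.
- by rewrite andbT => /eqP.
- by move/IH ->.
- by case/andP=> /IHf -> /IHg ->.
by case/andP=> /IHf -> /IHg ->.
Qed.

(** Marked trees are left out: they do not depend on [m] and only add a constant to an atom's
    count. *)
Definition counts_only D (S : {set labelling D}) (a : hatom tree_sig unit) :=
  [forall t, hcount a t false == (t \in S)].

(** Otherwise [separating_weights] gives two multiforests on which the sentence differs although all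
    atoms of [psi] agree, against 3-equivalence. *)
Lemma atom_for_set k (S : {set labelling (2 ^ k)}) (psi : hnf tree_sig (pname fact_coll)) :
  S != set0 -> d_equiv 3 (count_copies k) psi -> has (counts_only S) (hatoms psi).
Proof.
case/set0Pn=> t0 t0S equiv; apply: contraT => noS.
have [m [sat_m unsat_m agree]] := separating_weights
  (fun a => \sum_(x : marked_label S) hcount a (val x) true) (@hk _ _) t0S noS.
set m' := fun t => m t + (t == t0) in sat_m unsat_m agree.
have satE u : is_fact (Posz (\sum_(t in S) u t)) = hsat (multiforest t0S u) psi.
  rewrite -(@sat_multiforest _ S _ t0S u k (fun=> (inr (exist _ t0 t0S), insub_bseq _ [::]))) //.
  exact/equiv/forest_bounded.
move: unsat_m; rewrite satE -(@hsat_ext _ _ (multiforest t0S m)) -?satE ?sat_m //.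
apply: sub_all agree => a /andP[fE pE]; rewrite /hatom_sat.
rewrite -!/(in_hatom a _) !card_multiforest.
by case: (hP a) => [P|//]; exact: fE.
Qed.

Lemma occurs_nth (T : Type) (x0 : T) (s : seq T) i : i < size s -> occurs (nth x0 s i) s.
Proof. by elim: s i => // x s IH [|i] /= lt_i; [left | right; apply: IH]. Qed.

Lemma occurs_map (T : eqType) (U : Type) (f : T -> U) (s : seq T) y :
  occurs y (map f s) -> exists2 x, x \in s & y = f x.
Proof.
elim: s => //= x s IH [->|/IH[z zs ->]]; first by exists x; rewrite ?mem_head.
by exists z; rewrite // inE zs orbT.
Qed.

Lemma same_hatom_counts D (S S' : {set labelling D}) a b :
  same_hatom a b -> counts_only S a -> counts_only S' b -> S = S'.
Proof.
move=> ab /forallP aS /forallP bS'; apply/setP => t.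
suff : (t \in S) = (t \in S') :> nat by do 2!case: (t \in _).
rewrite -(eqP (aS t)) -(eqP (bS' t)); apply: eq_card => x.
by rewrite !inE (same_hatom_in _ ab).
Qed.

Lemma card_set_type (T : finType) : #|{: {set T}}| = 2 ^ #|T|.
Proof. by rewrite -[in RHS]cardsT -card_powerset powersetT cardsT. Qed.

(** The right-hand side is [tower 4 n.+1]; strictness leaves room for discarding the empty set. *)
Lemma tower_4_lt n : tower 4 n < 2 ^ #|{: labelling (2 ^ n.+1)}|.
Proof.
rewrite card_set_type card_tuple card_bool /= ltn_exp2l // ltn_exp2l // ltn_exp2l //.
by rewrite ltn_exp2l.
Qed.

Theorem theorem3p2 :
  exists C : PredColl, unary C /\
  exists sg : signature,
  exists phi : nat -> formula sg (pname C),
    (forall n, 0 < n -> fo_sentence (phi n)) /\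
    (exists c, forall n, 0 < n -> fsize (phi n) <= c * n) /\
    (forall n, 0 < n ->
     forall psi : hnf sg (pname C),
       hnf_wf psi -> d_equiv 3 (phi n) psi ->
       exists s : seq (hatom sg (pname C)),
         [/\ tower 4 n <= size s,
             (forall a, occurs a s -> occurs a (hatoms psi)) &
             (forall i j, i < j < size s ->
                forall a0, ~ same_hatom (nth a0 s i) (nth a0 s j))]).
Proof.
exists fact_coll; split=> //; exists tree_sig, (fun n => count_copies n.+1).
split=> [n _|]; first exact: count_copies_sentence.
split=> [|n _ psi _ equiv].
  (* The length is at most 100(n + 2), hence at most 300n for positive n. *)
  by exists 300 => n n_gt0; apply: leq_trans (count_copies_size _) _; lia.
(* The empty set offers no [t0] whose multiplicity could be raised. *)
pose sets := enum [set~ (set0 : {set labelling (2 ^ n.+1)})].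
have nonempty S : S \in sets -> has (counts_only S) (hatoms psi).
  by rewrite mem_enum !inE => S_ne; apply: atom_for_set.
(* Never returned on [sets], since [nonempty] makes [find] succeed there. *)
pose dflt : hatom tree_sig unit := HAtomMk None 0 [::] 0.
pose atom_of (S : {set labelling (2 ^ n.+1)}) :=
  nth dflt (hatoms psi) (find (counts_only S) (hatoms psi)).
exists (map atom_of sets); rewrite size_map; split.
- rewrite -cardE cardsC1 card_set_type -ltnS prednK ?expn_gt0 //.
  exact: tower_4_lt.
- move=> a a_in; have [S S_in ->] := occurs_map a_in; have hasS := nonempty S S_in.
  by apply: occurs_nth; rewrite -has_find.
move=> i j /andP[lt_ij lt_j] a0; have lt_i := ltn_trans lt_ij lt_j.
rewrite !(nth_map set0) // => same_ij.
have := same_hatom_counts same_ij (nth_find _ (nonempty _ (mem_nth _ lt_i)))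
  (nth_find _ (nonempty _ (mem_nth _ lt_j))).
by move/eqP; rewrite nth_uniq ?enum_uniq // (ltn_eqF lt_ij).
Qed.
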